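(* Let $\bar A\in\mathbb{R}^{m\times n}$ with rows $\bar A_i$, $\bar b\in\mathbb{R}^m$, $c\in\mathbb{R}^n$, $d\in\mathbb{R}$, and for each $i\in\{1,\dots,m\}$ let $\Delta\mathcal{U}_i\subset\mathbb{R}^{1\times n}\times\mathbb{R}$ be an uncertainty set with $(0,0)\in\Delta\mathcal{U}_i$. For $\epsilon>0$ consider the robust optimization problem $$(\mathrm{R}_\epsilon)\qquad\min_x\ c^Tx+d\quad\text{s.t. }(\bar A_i+\Delta A_i)x\le \bar b_i+\Delta b_i\ \text{ for all }(\Delta A_i,\Delta b_i)\in\epsilon\,\Delta\mathcal{U}_i\text{ and all } i,$$ and the first order problem $$(\mathrm{F})\qquad\min_\gamma\ c^T\gamma\quad\text{s.t. }\bar A_i\gamma\le-\max_{(\Delta A_i,\Delta b_i)\in\Delta\mathcal{U}_i}[(\Delta A_i)\bar x-\Delta b_i]\ \text{ for all } i \text{ such that }\bar A_i\bar x=\bar b_i.$$ Let $\bar\Gamma$ be the set of optimal solutions of $(\mathrm{F})$. Suppose: (1) the $\Delta\mathcal{U}_i$ are compact convex sets; (2) $\bar\Gamma$ is bounded; (3) there is some $\gamma'\in\mathbb{R}^n$ such that $\bar A_i\gamma'<0$ whenever $\bar A_i\bar x=\bar b_i$; (4) $\bar x$ is the unique minimizer of the nominal problem $\min\{c^Tx\mid\bar Ax\le\bar b\}$. Then the set of cluster points of any sequence $\{\frac1\epsilon(\bar x_\epsilon-\bar x)\}$, where $\bar x_\epsilon$ is an optimal solution of $(\mathrm{R}_\epsilon)$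 and $\epsilon\to0$ through positive values (along a sequence), is a subset of $\bar\Gamma$. The optimal objective value $\bar v_\epsilon$ of $(\mathrm{R}_\epsilon)$ satisfies $\bar v_\epsilon=\bar v+\epsilon\tilde v+o(\epsilon)$, where $\bar v=c^T\bar x+d$ and $\tilde v$ is the optimal objective value of $(\mathrm{F})$. In particular, if $\bar\Gamma$ contains only one element, say $\bar\gamma$, then $\lim_{\epsilon\to0}\frac1\epsilon(\bar x_\epsilon-\bar x)=\bar\gamma$, that is, $\bar x_\epsilon\in\bar x+\epsilon\bar\gamma+o(\epsilon)$.
   Context: Here $\epsilon\,\Delta\mathcal{U}_i=\{\epsilon u\mid u\in\Delta\mathcal{U}_i\}$. The sets $\Delta\mathcal{U}_i$ are translations, by the nominal data $(\bar A_i,\bar b_i)$, of uncertainty sets containing the nominal data, so they contain the origin. Vector inequalities are componentwise. *)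

(* Defs.v *)
From HB Require Import structures.
From mathcomp Require Import all_boot all_order all_algebra.
From mathcomp Require Import all_classical all_reals all_analysis.

Set Implicit Arguments.
Unset Strict Implicit.
Unset Printing Implicit Defensive.

Import Order.TTheory GRing.Theory Num.Theory.
Import numFieldNormedType.Exports.

Local Open Scope classical_set_scope.
Local Open Scope ring_scope.

Definition rdot (R : realType) (n : nat) (a : 'rV[R]_n) (x : 'cV[R]_n) : R :=
  (a *m x) 0 0.

Definition optimal_solutions (R : realType) (T : Type) (f : T -> R)
    (S : set T) : set T :=
  [set x | S x /\ forall y, S y -> f x <= f y].

(* Taken in the extended reals: +oo if S is empty, -oo if f is unbounded below
   on S. *)
Definition optimal_value (R : realType) (T : Type) (f : T -> R)
    (S : set T) : \bar R :=
  ereal_inf [set (f x)%:E | x in S].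

Definition nominal_feasible (R : realType) (m n : nat) (A : 'M[R]_(m, n))
    (b : 'cV[R]_m) : set 'cV[R]_n :=
  [set x | forall i, (A *m x) i 0 <= b i 0].

Definition robust_feasible (R : realType) (m n : nat) (A : 'M[R]_(m, n))
    (b : 'cV[R]_m) (dU : 'I_m -> set ('rV[R]_n * R)%type) (eps : R) :
    set 'cV[R]_n :=
  [set x | forall (i : 'I_m) (u : ('rV[R]_n * R)%type),
     [set eps *: v | v in dU i] u ->
     rdot (row i A + u.1) x <= b i 0 + u.2].

(* The maximum over the uncertainty set is written as a supremum, with which it
   coincides for the nonempty compact sets considered. *)
Definition first_order_feasible (R : realType) (m n : nat) (A : 'M[R]_(m, n))
    (b : 'cV[R]_m) (dU : 'I_m -> set ('rV[R]_n * R)%type)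
    (xbar : 'cV[R]_n) : set 'cV[R]_n :=
  [set g | forall i : 'I_m, (A *m xbar) i 0 = b i 0 ->
     rdot (row i A) g <= - sup [set rdot u.1 xbar - u.2 | u in dU i]].

(* Main.v *)
Require Import Defs.
From HB Require Import structures.
From mathcomp Require Import all_boot all_order all_algebra.
From mathcomp Require Import all_classical all_reals all_analysis.
From mathcomp Require Import lra.

Set Implicit Arguments.
Unset Strict Implicit.
Unset Printing Implicit Defensive.

Import Order.TTheory GRing.Theory Num.Theory.
Import numFieldNormedType.Exports.

Local Open Scope classical_set_scope.
Local Open Scope ring_scope.

(* Write a point as xbar + e g. Since xbar is the unique nominal optimum and
   compactness applies to the unit sphere, c^T g >= k |g| with k > 0 on the cone
   A_i g <= 0 (i active); both the first order feasible set and the rescaled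
   robust feasible set lie in this cone, because the uncertainty sets contain 0.
   Hence (F) is attained and all relevant g are bounded. The rescaled robust
   constraints of active rows differ from those of (F) only by terms
   e (Delta A_i) g = O(e), and moving by O(e) along a Slater direction turns
   feasible points of either problem into feasible points of the other. So the
   two rescaled values differ by O(e), and the rescaled robust optima satisfy
   (F) up to O(e), which gives the limit statements. *)

(** * The form [rdot] and compact sets of column vectors *)

Section rdot_theory.
Variables (R : realType) (n : nat).
Implicit Types (a : 'rV[R]_n) (x : 'cV[R]_n).

Lemma rdotE a x : rdot a x = \sum_j a 0 j * x j 0.
Proof. by rewrite /rdot mxE. Qed.

Lemma rdotDl a1 a2 x : rdot (a1 + a2) x = rdot a1 x + rdot a2 x.
Proof. by rewrite /rdot mulmxDl mxE. Qed.

Lemma rdotZl t a x : rdot (t *: a) x = t * rdot a x.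
Proof. by rewrite /rdot -scalemxAl mxE. Qed.

Lemma rdotDr a x1 x2 : rdot a (x1 + x2) = rdot a x1 + rdot a x2.
Proof. by rewrite /rdot mulmxDr mxE. Qed.

Lemma rdotZr a t x : rdot a (t *: x) = t * rdot a x.
Proof. by rewrite /rdot -scalemxAr mxE. Qed.

Lemma rdot0r a : rdot a 0 = 0.
Proof. by rewrite /rdot mulmx0 mxE. Qed.

Lemma rdot_row m (A : 'M[R]_(m, n)) x i : rdot (row i A) x = (A *m x) i 0.
Proof. by rewrite /rdot -row_mul mxE. Qed.

Lemma ler_mx_entry (p q : nat) (B : 'M[R]_(p, q)) i j : `|B i j| <= `|B|.
Proof.
rewrite [leRHS]/Num.Def.normr/= mx_normrE.
exact: (le_bigmax _ (fun k => `|B k.1 k.2|) (i, j)).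
Qed.

(** The norm is the largest absolute entry, so each of the [n] products is at most [|a| * |x|]. *)
Lemma ler_rdot a x : `|rdot a x| <= n%:R * `|a| * `|x|.
Proof.
rewrite rdotE (le_trans (ler_norm_sum _ _ _))//.
apply: (@le_trans _ _ (\sum_(j < n) `|a| * `|x|)).
  by apply: ler_sum => j _; rewrite normrM ler_pM// ler_mx_entry.
by rewrite sumr_const card_ord -mulrA mulr_natl.
Qed.

Lemma continuous_rdot a : continuous (rdot a).
Proof.
have -> : rdot a = \sum_j (fun x : 'cV[R]_n => a 0 j * x j 0).
  by apply/funext => x; rewrite rdotE fct_sumE.
move=> x; apply: (big_ind (fun f => {for x, continuous f})) => [|f g|j _].
- exact: cst_continuous.
- exact: continuousD.
- by apply: continuousM; [exact: cst_continuous|exact: coord_continuous].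
Qed.

Lemma closed_rdot_le a r : closed [set x | rdot a x <= r].
Proof.
by refine (preimage_closed _ (@closed_le _ r)) => x _; exact: continuous_rdot.
Qed.

Lemma closed_ball_norm (r : R) : closed [set x : 'cV[R]_n | `|x| <= r].
Proof.
by refine (preimage_closed _ (@closed_le _ r)) => x _; exact: norm_continuous.
Qed.

Lemma continuous_trmx (p q : nat) : continuous (@trmx R p q).
Proof.
move=> v S /= /nbhs_ballP[e e0 eS]; apply/nbhs_ballP; exists e => //= w [_ vw].
by apply: eS; split=> // i j; rewrite !mxE; exact: vw.
Qed.

(** Heine-Borel for columns, transported from rows through the transpose, which is continuous and
    keeps the entries. *)
Lemma cV_compact (S : set 'cV[R]_n) (r : R) :
  closed S -> (forall x, S x -> `|x| <= r) -> compact S.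
Proof.
move=> Scl Sr.
have -> : S = @trmx R 1 n @` (@trmx R 1 n @^-1` S).
  apply/seteqP; split => [x Sx|_ [v Sv <-]//].
  by exists x^T; rewrite /preimage/= trmxK.
apply: continuous_compact.
  by apply: continuous_subspaceT; exact: continuous_trmx.
apply: bounded_closed_compact.
  exists r; split; [exact: num_real|move=> M /ltW rM v /= /Sr vr].
  apply: le_trans (le_trans vr rM).
  rewrite [leLHS]/Num.Def.normr/= mx_normrE bigmax_le// => -[i j] _.
  by have := ler_mx_entry v^T j i; rewrite mxE.
by refine (preimage_closed _ Scl) => v _; exact: continuous_trmx.
Qed.
End rdot_theory.

(** Slack absorbs a small multiple of any constant; this serves inactive rows and the removal of
    [O(e)] errors in limits. *)
Lemma near0_affine_le (R : realType) (a b p : R) : a < b ->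
  \forall t \near 0^'+, a + t * p <= b.
Proof.
move=> ab; near=> t.
have t0 : 0 < t by near: t; exact: nbhs_right_gt.
have pp : 0 < `|p| + 1 by apply: ltr_pwDr.
have : t * (`|p| + 1) <= b - a.
  rewrite -ler_pdivlMr//; near: t; apply: nbhs_right_le.
  by rewrite divr_gt0// subr_gt0.
have := ler_norm p; nra.
Unshelve. all: by end_near. Qed.

(** * Feasible directions at the nominal optimum and coercivity of the cost *)

Section perturbation.
Variables (R : realType) (m n : nat) (A : 'M[R]_(m, n)) (b : 'cV[R]_m).
Variables (c : 'cV[R]_n) (dU : 'I_m -> set ('rV[R]_n * R)%type).
Variable xbar : 'cV[R]_n.
Hypothesis dU0 : forall i, dU i (0, 0).
Hypothesis dU_compact : forall i, compact (dU i).
Hypothesis slater : exists g' : 'cV[R]_n, forall i : 'I_m,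
  (A *m xbar) i 0 = b i 0 -> rdot (row i A) g' < 0.
Hypothesis xbar_unique :
  optimal_solutions (rdot c^T) (nominal_feasible A b) = [set xbar].

Let active i := (A *m xbar) i 0 = b i 0.
Let s i := sup [set rdot u.1 xbar - u.2 | u in dU i].
Let Feas := first_order_feasible A b dU xbar.
Let robust := robust_feasible A b dU.

Lemma xbar_feasible i : (A *m xbar) i 0 <= b i 0.
Proof.
have : [set xbar] xbar by [].
by rewrite -xbar_unique => -[].
Qed.

(** Active rows do not increase along [g]; the finitely many inactive rows have positive slack,
    which survives a short step. *)
Lemma feasible_direction g : (forall i, active i -> rdot (row i A) g <= 0) ->
  exists2 t : R, 0 < t & nominal_feasible A b (xbar + t *: g).
Proof.
move=> gI; suff : \forall t \near 0^'+, nominal_feasible A b (xbar + t *: g).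
  move=> H; have [t [t0 tg]] := @filter_ex _ (0^'+ : set_system R) _ _
    (filterI (nbhs_right_gt 0) H).
  by exists t.
near=> t => i; have t0 : 0 < t by near: t; exact: nbhs_right_gt.
rewrite -rdot_row rdotDr rdotZr rdot_row.
have [ai|ai] := pselect (active i).
  by rewrite ai gerDl pmulr_rle0// gI.
(* [t] must not depend on the row; finitely many conditions near 0 hold jointly. *)
move: i ai; near: t; apply: filter_forall => i.
have [ai|ai] := pselect (active i); first exact: nearW.
have lt_b : (A *m xbar) i 0 < b i 0.
  by rewrite lt_neqAle xbar_feasible andbT; exact/eqP.
by have := near0_affine_le (rdot (row i A) g) lt_b; apply: filterS.
Unshelve. all: by end_near. Qed.

(** Otherwise a short step along [g] would reach a second nominal minimizer. *)
Lemma objective_direction_gt0 g :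
  (forall i, active i -> rdot (row i A) g <= 0) -> g != 0 ->
  0 < rdot c^T g.
Proof.
move=> gI g0; rewrite ltNge; apply/negP => cg.
have [t t0 tf] := feasible_direction gI.
have : [set xbar] xbar by [].
rewrite -xbar_unique => -[_ xbar_min].
have : optimal_solutions (rdot c^T) (nominal_feasible A b) (xbar + t *: g).
  split=> // y yf; apply: le_trans (xbar_min y yf).
  by rewrite rdotDr rdotZr gerDl pmulr_rle0.
rewrite xbar_unique /= => /eqP; rewrite -subr_eq0 addrAC subrr add0r.
by rewrite scaler_eq0 (gt_eqF t0) (negbTE g0).
Qed.

Lemma objective_coercive : exists2 k : R, 0 < k & forall g,
  (forall i, active i -> rdot (row i A) g <= 0) -> k * `|g| <= rdot c^T g.
Proof.
pose C := \bigcap_(i in active) [set g | rdot (row i A) g <= 0].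
pose S := C `&` ([set g : 'cV[R]_n | `|g| <= 1] `&` [set g | 1 <= `|g|]).
have Scl : closed S.
  apply: closedI; first by apply: closed_bigI => i _; exact: closed_rdot_le.
  apply: closedI; first exact: closed_ball_norm.
  by refine (preimage_closed _ (@closed_ge _ 1)) => x _; exact: norm_continuous.
have Sco : compact S by apply: (cV_compact Scl (r := 1)) => g [_ []].
have normalize g : C g -> g != 0 -> S (`|g|^-1 *: g).
  move=> Cg g0; have ng : 0 < `|g| by rewrite normr_gt0.
  have n1 : `| `|g|^-1 *: g| = 1.
    by rewrite normrZ normfV normr_id mulVf// gt_eqF.
  split; last by split; rewrite /= n1.
  by move=> i ai; rewrite /= rdotZr pmulr_rle0 ?invr_gt0//; exact: Cg.
have [k k0 Sk] : exists2 k : R, 0 < k & forall g, S g -> k <= rdot c^T g.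
  have [S0|S0] := pselect (S !=set0); last first.
    (* The cone may be trivial; [S] is then empty and any positive constant will do. *)
    by exists 1 => // g Sg; case: S0; exists g.
  have [g] := compact_EVT_min S0 Sco
    (continuous_subspaceT (@continuous_rdot _ _ c^T)).
  rewrite inE => -[Cg [_ g1]] gmin; exists (rdot c^T g).
    apply: objective_direction_gt0 => //.
    by apply/eqP => g0; move: g1; rewrite /= g0 normr0 ler10.
  by move=> h Sh; apply: gmin; rewrite inE.
exists k => // g gI; have [->|g0] := eqVneq g 0.
  by rewrite normr0 mulr0 rdot0r.
have := Sk _ (normalize g gI g0); rewrite rdotZr.
by rewrite mulrC ler_pdivlMr ?normr_gt0.
Qed.

(** * Uniform bounds on the perturbations *)

Lemma uncertainty_bound : exists2 M : R, 0 <= M & forall i u, dU i u ->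
  `|rdot u.1 xbar - u.2| <= M /\ forall y, `|rdot u.1 y| <= M * `|y|.
Proof.
have /choice[B HB] i : exists B, forall u, dU i u -> `|u| <= B.
  have [B [_ HB]] := compact_bounded (@dU_compact i).
  by exists (B + 1) => u du; apply: HB => //; rewrite ltrDl.
pose N := \sum_i `|B i|.
have N0 : 0 <= N by apply: sumr_ge0.
have NB i u : dU i u -> `|u| <= N.
  move=> du; rewrite (le_trans (HB _ _ du))// (le_trans (ler_norm _))//.
  by rewrite /N (bigD1 i)//= lerDl sumr_ge0.
have n0 : 0 <= n%:R :> R by [].
have rdN i u y : dU i u -> `|rdot u.1 y| <= n%:R * N * `|y|.
  move=> du; rewrite (le_trans (ler_rdot _ _))// ler_wpM2r// ler_wpM2l//.
  by rewrite (le_trans _ (NB _ _ du))// prod_normE le_max lexx.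
have x0 := normr_ge0 xbar.
(* The part [n * N * |xbar| + N] bounds the first quantity; the added 1 makes the constant at least
   [n * N], as the second needs. *)
exists (n%:R * N * (`|xbar| + 1) + N) => [|i u du].
  by rewrite addr_ge0// !mulr_ge0// addr_ge0.
split=> [|y].
  rewrite (le_trans (ler_normB _ _))// lerD//.
    by rewrite (le_trans (rdN _ _ _ du))// ler_wpM2l ?mulr_ge0// lerDl.
  by rewrite (le_trans _ (NB _ _ du))// prod_normE le_max lexx orbT.
rewrite (le_trans (rdN _ _ _ du))// ler_wpM2r//.
have : 0 <= n%:R * N by rewrite mulr_ge0.
nra.
Qed.

Lemma has_sup_perturbation i : has_sup [set rdot u.1 xbar - u.2 | u in dU i].
Proof.
split; first by exists (rdot 0 xbar - 0), (0, 0).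
have [M _ HM] := uncertainty_bound.
exists M => _ [u du <-]; rewrite (le_trans (ler_norm _))//.
by have [] := HM _ _ du.
Qed.

Lemma le_perturbation_sup i u : dU i u -> rdot u.1 xbar - u.2 <= s i.
Proof.
by move=> du; apply: ub_le_sup; [exact: (has_sup_perturbation i).2|exists u].
Qed.

(** The origin contributes the value 0. This sign confines (F) to the cone where the cost is
    coercive. *)
Lemma perturbation_sup_ge0 i : 0 <= s i.
Proof.
by have := le_perturbation_sup (dU0 i); rewrite /= /rdot mul0mx mxE subrr.
Qed.

Lemma first_order_direction g : Feas g ->
  forall i, active i -> rdot (row i A) g <= 0.
Proof.
by move=> Fg i ai; rewrite (le_trans (Fg i ai))// oppr_le0 perturbation_sup_ge0.
Qed.

(** * Slater directions and attainment in (F) *)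

Lemma slater_unit : exists g', forall i, active i -> rdot (row i A) g' <= -1.
Proof.
have [g' Hg'] := slater.
suff : \forall t \near 0^'+, forall i, active i -> t + rdot (row i A) g' <= 0.
  move=> H; have [t [t0 tg]] := @filter_ex _ (0^'+ : set_system R) _ _
    (filterI (nbhs_right_gt 0) H).
  (* [t] is a margin common to all active rows. After division by it, a step of length [r >= 0]
     lowers each of them by at least [r]. *)
  exists (t^-1 *: g') => i ai; rewrite rdotZr mulrC ler_pdivrMr// mulN1r.
  by rewrite -subr_le0 opprK addrC tg.
apply: filter_forall => i.
have [ai|ai] := pselect (active i); last exact: nearW.
have := near0_affine_le 1 (Hg' _ ai); apply: filterS => t.
by rewrite mulr1 addrC.
Qed.

Lemma first_order_feasible_nonempty : exists g, Feas g.
Proof.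
have [g' Hg'] := slater_unit.
(* All [s i] are nonnegative, so their sum dominates each of them. *)
pose S := \sum_i s i; exists (S *: g') => i ai.
have S0 : 0 <= S by apply: sumr_ge0 => j _; exact: perturbation_sup_ge0.
rewrite rdotZr (@le_trans _ _ (S * -1))//; first by rewrite ler_wpM2l// Hg'.
rewrite mulrN1 lerN2 /S (bigD1 i)//= lerDl.
by apply: sumr_ge0 => j _; exact: perturbation_sup_ge0.
Qed.

Lemma closed_first_order_feasible : closed Feas.
Proof.
have -> : Feas = \bigcap_(i in active) [set g | rdot (row i A) g <= - s i].
  by [].
by apply: closed_bigI => i _; exact: closed_rdot_le.
Qed.

(** Coercivity makes the feasible sublevel set of [g0] compact, and feasible points outside it cost
    more than [g0]. *)
Lemma first_order_attained : exists g, optimal_solutions (rdot c^T) Feas g.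
Proof.
have [g0 Fg0] := first_order_feasible_nonempty.
have [k k0 Hk] := objective_coercive.
pose S := Feas `&` [set g | rdot c^T g <= rdot c^T g0].
have Scl : closed S.
  by apply: closedI; [exact: closed_first_order_feasible|exact: closed_rdot_le].
have Sco : compact S.
  apply: (cV_compact Scl (r := rdot c^T g0 / k)) => g [Fg /= cg].
  rewrite ler_pdivlMr// mulrC (le_trans _ cg)// Hk//.
  exact: first_order_direction.
have [|g] := compact_EVT_min _ Sco
  (continuous_subspaceT (@continuous_rdot _ _ c^T)).
  by exists g0; split=> //=.
rewrite inE => -[Fg /= cg] gmin; exists g; split=> // y Fy.
have [cy|/ltW cy] := leP (rdot c^T y) (rdot c^T g0); last exact: le_trans cg cy.
by apply: gmin; rewrite inE.
Qed.

(** * Comparison of the rescaled robust problem with (F) *)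

Lemma robust_rescaled e g : robust e (xbar + e *: g) <->
  forall i u, dU i u ->
    (A *m xbar) i 0 +
      e * (rdot (row i A) g + (rdot u.1 xbar - u.2) + e * rdot u.1 g) <= b i 0.
Proof.
suff E i (u : 'rV[R]_n * R) :
    (rdot (row i A + (e *: u).1) (xbar + e *: g) <= b i 0 + (e *: u).2) =
    ((A *m xbar) i 0 +
      e * (rdot (row i A) g + (rdot u.1 xbar - u.2) + e * rdot u.1 g) <= b i 0).
  split=> H i u; first by move=> du; rewrite -E; apply: H; exists u.
  by move=> [v dv <-]; rewrite E; exact: H.
(* Perturbation and displacement both scale with [e]: the terms linear in [e] form the constraint of
   (F), and their product leaves a quadratic one. *)
rewrite /= rdotDl !rdotDr !rdotZl !rdotZr rdot_row -[_ *: u.2]/(e * u.2).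
by apply/idP/idP; lra.
Qed.

Lemma robust_directional e g i u : 0 < e -> robust e (xbar + e *: g) ->
  active i -> dU i u ->
  rdot (row i A) g + (rdot u.1 xbar - u.2) + e * rdot u.1 g <= 0.
Proof.
move=> e0 /robust_rescaled rg ai du; have := rg i u du.
by rewrite ai gerDl pmulr_rle0.
Qed.

(** The nominal data, [u = 0], put robust displacements in the cone of coercivity. *)
Lemma robust_direction e g : 0 < e -> robust e (xbar + e *: g) ->
  forall i, active i -> rdot (row i A) g <= 0.
Proof.
move=> e0 rg i ai; have := robust_directional e0 rg ai (dU0 i).
by rewrite /= /rdot !mul0mx !mxE subrr mulr0 !addr0.
Qed.

(* The curvature term [e^2 * rdot u.1 g] is absorbed by a correction of size
   [O(e)] along a Slater direction. *)
Lemma robust_near_first_order : exists2 L : R, 0 <= L &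
  \forall e \near 0^'+, exists2 g, robust e (xbar + e *: g) &
    forall v, optimal_solutions (rdot c^T) Feas v ->
      rdot c^T g <= rdot c^T v + L * e.
Proof.
have [gs [Fgs gs_min]] := first_order_attained.
have [g' Hg'] := slater_unit.
have [M M0 HM] := uncertainty_bound.
(* [T] bounds [rdot u.1] at the corrected point as soon as [e * T <= 1]. *)
pose T := M * (`|gs| + `|g'|).
have T0 : 0 <= T by rewrite mulr_ge0// addr_ge0.
exists (T * `|rdot c^T g'|); first by rewrite mulr_ge0.
(* Invertible even when [T = 0]; [e <= K^-1] gives [e * T <= 1]. *)
pose K := 1 + T.
have K0 : 0 < K by rewrite ltr_pwDl.
near=> e.
have e0 : 0 < e by near: e; exact: nbhs_right_gt.
have e1 : e <= 1 by near: e; exact: nbhs_right_le.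
have eT : e * T <= 1.
  have : e <= K^-1 by near: e; apply: nbhs_right_le; rewrite invr_gt0.
  by rewrite -(ler_pM2r K0) mulVf ?gt_eqF// /K; nra.
have eT0 : 0 <= e * T by rewrite mulr_ge0// ltW.
exists (gs + (e * T) *: g'); last first.
  move=> v [Fv _]; rewrite rdotDr rdotZr lerD//; first exact: gs_min.
  by rewrite [leRHS]mulrC [leRHS]mulrA ler_wpM2l ?ler_norm.
apply/robust_rescaled => i u du.
have [Mu MG] := HM i u du.
have uT : rdot u.1 (gs + (e * T) *: g') <= T.
  rewrite (le_trans (ler_norm _))// (le_trans (MG _))// ler_wpM2l//.
  rewrite (le_trans (ler_normD _ _))// lerD// normrZ ger0_norm//.
  by rewrite ler_piMl.
have [ai|ai] := pselect (active i).
  rewrite ai gerDl pmulr_rle0// rdotDr rdotZr.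
  (* The sum is at most [- s i - e * T + s i + e * T]. *)
  have := Fgs i ai; rewrite -/(s i) => H1.
  have := Hg' i ai; have := le_perturbation_sup du.
  nra.
rewrite rdotDr rdotZr.
(* Inactive row: the bracket is bounded independently of [u] and [e], so the slack absorbs it for
   small [e]. *)
apply: (@le_trans _ _ ((A *m xbar) i 0 + e *
    (`|rdot (row i A) gs| + `|rdot (row i A) g'| + M + T))).
  rewrite lerD2l ler_pM2l// lerD//.
    rewrite lerD// ?(le_trans (ler_norm _) Mu)// lerD// ?ler_norm//.
    by rewrite (le_trans (ler_norm _))// normrM ger0_norm// ler_piMl.
  by have := uT; nra.
move: i ai {u du Mu MG uT}; near: e; apply: filter_forall => i.
have [ai|ai] := pselect (active i); first exact: nearW.
have lt_b : (A *m xbar) i 0 < b i 0.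
  by rewrite lt_neqAle xbar_feasible andbT; exact/eqP.
pose p := `|rdot (row i A) gs| + `|rdot (row i A) g'| + M + T.
by have := near0_affine_le p lt_b; apply: filterS.
Unshelve. all: by end_near. Qed.

(** Each [u] bounds [rdot u.1 xbar - u.2] by a quantity free of [u], so the bound passes to the
    supremum [s i]. *)
Lemma robust_almost_first_order : exists2 M : R, 0 <= M &
  forall e g, 0 < e -> robust e (xbar + e *: g) ->
  forall i, active i -> rdot (row i A) g <= - s i + e * (M * `|g|).
Proof.
have [M M0 HM] := uncertainty_bound.
exists M => // e g e0 rg i ai.
suff : s i <= - rdot (row i A) g + e * (M * `|g|) by lra.
apply: ge_sup; first exact: (has_sup_perturbation i).1.
move=> _ [u du <-]; have := robust_directional e0 rg ai du.
have [_ /(_ g)] := HM i u du; rewrite ler_norml => /andP[+ _].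
nra.
Qed.

(** A bounded robust displacement violates (F) by [O(e)]; a Slater step of that size repairs it at
    cost [O(e)], and the optimality of [v] applies. *)
Lemma robust_objective_lower : exists2 L : R, 0 <= L &
  forall e g v, 0 < e -> robust e (xbar + e *: g) ->
    optimal_solutions (rdot c^T) Feas v -> rdot c^T v - L * e <= rdot c^T g.
Proof.
have [k k0 Hk] := objective_coercive.
have [M M0 HM] := robust_almost_first_order.
have [g' Hg'] := slater_unit.
have [gs [Fgs gs_min]] := first_order_attained.
(* By coercivity [K] bounds the displacements cheaper than the optimum. It is built from [gs]
   because [L] is chosen before [v]. *)
pose K := `|rdot c^T gs| / k.
have K0 : 0 <= K by rewrite divr_ge0// ltW.
exists (M * K * `|rdot c^T g'|); first by rewrite mulr_ge0// mulr_ge0.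
move=> e g v e0 rg [Fv vmin].
have Le : 0 <= M * K * `|rdot c^T g'| * e.
  by rewrite mulr_ge0 ?(ltW e0)// mulr_ge0// mulr_ge0.
have [cv|cv] := leP (rdot c^T v) (rdot c^T g).
  by rewrite (le_trans _ cv)// gerBl.
have gK : `|g| <= K.
  rewrite ler_pdivlMr// mulrC (le_trans (Hk _ (robust_direction e0 rg)))//.
  by rewrite (le_trans (ltW cv))// (le_trans (vmin _ Fgs))// ler_norm.
have : Feas (g + (e * (M * K)) *: g').
  move=> i ai; rewrite rdotDr rdotZr -/(s i).
  have := HM _ _ e0 rg _ ai; have := Hg' i ai.
  have : M * `|g| <= M * K by rewrite ler_wpM2l.
  have : 0 <= e * (M * K) by rewrite mulr_ge0 ?(ltW e0)// mulr_ge0.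
  nra.
move=> /vmin; rewrite rdotDr rdotZr.
have := ler_norm (rdot c^T g').
have : 0 <= e * (M * K) by rewrite mulr_ge0 ?(ltW e0)// mulr_ge0.
nra.
Qed.

(** * Expansion of the value and limits of the robust solutions *)

Section objective_offset.
Variable d : R.
Let obj x := rdot c^T x + d.
Let Gamma := optimal_solutions (rdot c^T) Feas.
Local Notation rescale e x := (e^-1 *: (x - xbar)).

Lemma rescaleK e x : 0 < e -> xbar + e *: rescale e x = x.
Proof. by move=> e0; rewrite scalerA mulfV ?gt_eqF// scale1r subrKC. Qed.

Lemma obj_rescaled e g : obj (xbar + e *: g) = obj xbar + e * rdot c^T g.
Proof. by rewrite /obj rdotDr rdotZr addrAC. Qed.

(** The cost of [g] enters the objective multiplied by [e], so the two [O(e)] comparisons with (F)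
    leave an [O(e^2)] error. *)
Lemma robust_value_expansion v : Gamma v -> exists2 L : R, 0 <= L &
  \forall e \near 0^'+, exists2 w, optimal_value obj (robust e) = w%:E &
    `|w - (obj xbar + e * rdot c^T v)| <= L * e ^+ 2.
Proof.
move=> Gv.
have [L1 L10 H1] := robust_near_first_order.
have [L2 L20 H2] := robust_objective_lower.
exists (L1 + L2); first by rewrite addr_ge0.
near=> e; have e0 : 0 < e by near: e; exact: nbhs_right_gt.
have [g rg /(_ v Gv) gv] : exists2 g, robust e (xbar + e *: g) &
    forall v, Gamma v -> rdot c^T g <= rdot c^T v + L1 * e by near: e.
have hi : (optimal_value obj (robust e) <=
    (obj xbar + e * (rdot c^T v + L1 * e))%:E)%E.
  apply: ge_ereal_inf; exists (obj (xbar + e *: g))%:E.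
    by exists (xbar + e *: g).
  by rewrite lee_fin obj_rescaled lerD2l ler_pM2l.
have lo : ((obj xbar + e * (rdot c^T v - L2 * e))%:E <=
    optimal_value obj (robust e))%E.
  apply: le_ereal_inf_tmp => _ [x rx <-].
  rewrite lee_fin -(rescaleK x e0) obj_rescaled lerD2l ler_pM2l//.
  by apply: H2 => //; rewrite rescaleK.
have /fineK Ew : optimal_value obj (robust e) \is a fin_num.
  by rewrite fin_numElt (lt_le_trans _ lo) ?ltNyr// (le_lt_trans hi) ?ltry.
exists (fine (optimal_value obj (robust e))) => //.
move: lo hi; rewrite -Ew !lee_fin => lo hi.
have L1e : 0 <= L1 * e ^+ 2 by rewrite mulr_ge0// exprn_ge0// ltW.
have L2e : 0 <= L2 * e ^+ 2 by rewrite mulr_ge0// exprn_ge0// ltW.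
by rewrite ler_norml; apply/andP; split; nra.
Unshelve. all: by end_near. Qed.

(** A robust optimum costs no more than the corrected optimum of (F). Coercivity turns this into the
    bound [K], which makes the row errors [O(e)]. *)
Lemma robust_solution_estimate v : Gamma v -> exists K L : R,
  \forall e \near 0^'+, forall x, optimal_solutions obj (robust e) x ->
    [/\ `|rescale e x| <= K, rdot c^T (rescale e x) <= rdot c^T v + L * e &
      forall i, active i -> rdot (row i A) (rescale e x) <= - s i + L * e].
Proof.
move=> Gv.
have [k k0 Hk] := objective_coercive.
have [L1 L10 H1] := robust_near_first_order.
have [M M0 H2] := robust_almost_first_order.
pose K := (rdot c^T v + L1) / k.
exists K, (L1 + M * `|K|); near=> e => x [rx xmin].
have e0 : 0 < e by near: e; exact: nbhs_right_gt.
have e1 : e <= 1 by near: e; exact: nbhs_right_le.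
have [g rg /(_ v Gv) gv] : exists2 g, robust e (xbar + e *: g) &
    forall v, Gamma v -> rdot c^T g <= rdot c^T v + L1 * e by near: e.
have rx' : robust e (xbar + e *: rescale e x) by rewrite rescaleK.
have cx : rdot c^T (rescale e x) <= rdot c^T v + L1 * e.
  apply: le_trans gv.
  have := xmin _ rg; rewrite -[in X in X -> _](rescaleK x e0) !obj_rescaled.
  by rewrite lerD2l ler_pM2l.
have xK : `|rescale e x| <= K.
  rewrite ler_pdivlMr// mulrC (le_trans (Hk _ (robust_direction e0 rx')))//.
  by rewrite (le_trans cx)// lerD2l ler_piMr.
have MK : 0 <= M * `|K| by rewrite mulr_ge0.
split=> // [|i ai]; first by nra.
apply: (le_trans (H2 _ _ e0 rx' i ai)).
have : M * `|rescale e x| <= M * `|K|.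
  by rewrite ler_wpM2l// (le_trans xK)// ler_norm.
nra.
Unshelve. all: by end_near. Qed.

(** A general filter covers both sequences and the limit at [0^'+]. *)
Lemma cluster_robust_solutions (T : Type) (F : set_system T) (e : T -> R)
    (x : T -> 'cV[R]_n) : ProperFilter F -> e @ F --> 0^'+ ->
  (\forall t \near F, optimal_solutions obj (robust (e t)) (x t)) ->
  cluster ((fun t => rescale (e t) (x t)) @ F) `<=` Gamma.
Proof.
move=> FF eF xF g clg.
have [v [Fv vmin]] := first_order_attained.
have [K [L KL]] := robust_solution_estimate (conj Fv vmin).
(* The error [L * e] eventually drops below any [eta], and closed half-spaces keep cluster
   points. *)
have limit (a : 'rV[R]_n) r : (\forall e \near 0^'+, forall x,
    optimal_solutions obj (robust e) x -> rdot a (rescale e x) <= r + L * e) ->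
    rdot a g <= r.
  move=> ar; apply/ler_addgt0Pr => eta eta0.
  suff : closure [set h | rdot a h <= r + eta] g.
    by move=> /closed_rdot_le.
  move: clg; rewrite clusterE; apply.
  have : \forall e \near 0^'+, forall x, optimal_solutions obj (robust e) x ->
      rdot a (rescale e x) <= r + eta.
    near=> u => y yopt.
    apply: (@le_trans _ _ (r + L * u)).
      by move: y yopt; near: u.
    rewrite lerD2l -[L * u]add0r mulrC.
    by near: u; apply: near0_affine_le.
  move=> /eF; apply: filterS2 xF => t xt /= H; exact: H.
have Fg : Feas g.
  move=> i ai; apply: limit; apply: filterS KL => u H y /H[_ _]; exact.
have cg : rdot c^T g <= rdot c^T v.
  by apply: limit; apply: filterS KL => u H y /H[].
by split=> // y /vmin; exact: le_trans.
Unshelve. all: by end_near. Qed.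

(** The rescaled optima end up in a compact ball where [gbar] is the only cluster point, which
    forces convergence. *)
Lemma cvg_robust_solutions (x : R -> 'cV[R]_n) gbar : Gamma = [set gbar] ->
  (\forall e \near 0^'+, optimal_solutions obj (robust e) (x e)) ->
  rescale e (x e) @[e --> 0^'+] --> gbar.
Proof.
move=> G1 xopt.
have Gg : Gamma gbar by rewrite G1.
have [K [L KL]] := robust_solution_estimate Gg.
(* The second radius makes [V] a neighbourhood of [gbar]. *)
pose V := [set g : 'cV[R]_n | `|g| <= Num.max K (`|gbar| + 1)].
have Vco : compact V.
  apply: (cV_compact (r := Num.max K (`|gbar| + 1))) => //.
  exact: closed_ball_norm.
have FV : ((fun e => rescale e (x e)) @ 0^'+) V.
  by apply: filterS2 xopt KL => e xe /(_ _ xe)[H _ _]; rewrite /V /= le_max H.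
have clG := cluster_robust_solutions (e := id) _ (@cvg_id _ _) xopt.
apply: (compact_cluster_set1 (@norm_hausdorff _ _) Vco) => //.
  rewrite -nbhs_ballE; exists 1 => //= h; rewrite -ball_normE /= => gh.
  rewrite /V /= le_max; apply/orP; right.
  by rewrite -(subrKC gbar h) (le_trans (ler_normD _ _))// lerD2l distrC ltW.
(* Compactness shows that the cluster set is not empty, hence equal to the singleton. *)
have [g [Vg clg]] := Vco _ _ FV.
have /= gE : [set gbar] g by rewrite -G1; exact: clG.
apply/seteqP; split=> [h /clG|_ ->]; first by rewrite -/Gamma G1.
by rewrite -gE.
Qed.
End objective_offset.

End perturbation.

(** * Attained values, one-sided limits and the final assembly *)

Lemma optimal_value_attained (R : realType) (T : Type) (f : T -> R)
    (S : set T) v :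
  optimal_solutions f S v -> optimal_value f S = (f v)%:E.
Proof.
move=> [Sv vmin]; apply/eqP; rewrite eq_le; apply/andP; split.
  by apply: ge_ereal_inf; exists (f v)%:E => //; exists v.
by apply: le_ereal_inf_tmp => _ [x Sx <-]; rewrite lee_fin vmin.
Qed.

Lemma sequence_at_right0 (R : realType) (e : nat -> R) :
  (forall k, 0 < e k) -> e @ \oo --> (0 : R) -> e @ \oo --> 0^'+.
Proof.
move=> e0 ecvg P P0.
have : \forall k \near \oo, 0 < e k -> P (e k) := ecvg _ P0.
by apply: filterS => k; apply.
Qed.
Theorem corollary2p4 (R : realType) (m n : nat) (A : 'M[R]_(m, n))
    (b : 'cV[R]_m) (c : 'cV[R]_n) (d : R)
    (dU : 'I_m -> set ('rV[R]_n * R)%type) (xbar : 'cV[R]_n)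
    (dU0 : forall i, dU i (0, 0))
    (dU_compact : forall i, compact (dU i))
    (dU_convex : forall i, convex_set (dU i))
    (Gamma_bounded : bounded_set
       (optimal_solutions (rdot c^T) (first_order_feasible A b dU xbar)))
    (slater : exists g' : 'cV[R]_n, forall i : 'I_m,
       (A *m xbar) i 0 = b i 0 -> rdot (row i A) g' < 0)
    (xbar_unique : optimal_solutions (rdot c^T) (nominal_feasible A b)
                   = [set xbar]) :
  let obj := fun x : 'cV[R]_n => rdot c^T x + d in
  let Gamma :=
    optimal_solutions (rdot c^T) (first_order_feasible A b dU xbar) in
  [/\ forall (eps : nat -> R) (x : nat -> 'cV[R]_n),
        (forall k, 0 < eps k) -> eps @ \oo --> (0 : R) ->
        (forall k,
           optimal_solutions obj (robust_feasible A b dU (eps k)) (x k)) ->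
        cluster ((fun k => (eps k)^-1 *: (x k - xbar)) @ \oo) `<=` Gamma,
      exists (vtilde : R) (r : R -> R),
        [/\ optimal_value (rdot c^T) (first_order_feasible A b dU xbar)
              = vtilde%:E,
            r =o_ (0^'+) (@id R) &
            \forall eps \near 0^'+,
              optimal_value obj (robust_feasible A b dU eps)
              = (obj xbar + eps * vtilde + r eps)%:E]
    & forall gbar : 'cV[R]_n, Gamma = [set gbar] ->
        forall x : R -> 'cV[R]_n,
          (\forall eps \near 0^'+,
             optimal_solutions obj (robust_feasible A b dU eps) (x eps)) ->
          eps^-1 *: (x eps - xbar) @[eps --> 0^'+] --> gbar /\
          (fun eps => x eps - (xbar + eps *: gbar)) =o_ (0^'+) (@id R)].
Proof.
move=> obj Gamma; split.
- move=> eps x eps0 epscvg xopt.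
  apply: (cluster_robust_solutions dU0 dU_compact slater xbar_unique (d := d)).
    exact: sequence_at_right0.
  exact: nearW.
- have [v Gv] := first_order_attained dU0 dU_compact slater xbar_unique.
  have [L L0 HL] :=
    robust_value_expansion dU0 dU_compact slater xbar_unique d Gv.
  (* [fine] sends infinite values to 0; none occur for small [e > 0]. *)
  pose r e := fine (optimal_value obj (robust_feasible A b dU e))
              - (obj xbar + e * rdot c^T v).
  exists (rdot c^T v), r; split.
  + exact: optimal_value_attained.
  + apply/eqoP => eta /= eta0; near=> e.
    have e0 : 0 < e by near: e; exact: nbhs_right_gt.
    have [w Ew] : exists2 w, optimal_value obj (robust_feasible A b dU e) = w%:E
        & `|w - (obj xbar + e * rdot c^T v)| <= L * e ^+ 2 by near: e.
    rewrite /r Ew /= (gtr0_norm e0) => /le_trans; apply.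
    (* [L * e^2 <= eta * e] as soon as [L * e <= eta]. *)
    rewrite expr2 mulrA ler_pM2r// -[L * e]add0r mulrC.
    by near: e; exact: near0_affine_le.
  + by apply: filterS HL => e [w Ew _]; rewrite /r Ew subrKC.
- move=> gbar G1 x xopt.
  have xcvg := cvg_robust_solutions dU0 dU_compact slater xbar_unique G1 xopt.
  split=> //; apply/eqoP => eta /= eta0; near=> e.
  have e0 : 0 < e by near: e; exact: nbhs_right_gt.
  have H : `|gbar - e^-1 *: (x e - xbar)| <= eta.
    by near: e; exact: cvgr_dist_le.
  (* The residual is [e] times the error of the rescaled solution, which tends to 0. *)
  have -> : x e - (xbar + e *: gbar) = - (e *: (gbar - e^-1 *: (x e - xbar))).
    rewrite scalerBr scalerA mulfV ?gt_eqF// scale1r opprB opprD addrA.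
    by [].
  by rewrite normrN normrZ mulrC ler_pM2r ?normr_gt0 ?gt_eqF.
Unshelve. all: by end_near. Qed.
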